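(* Let $\alpha,\beta\ge 0$ be fixed constants. A helicoidal ribbon, with parameters $A<B$ and $\omega$, that is stationary for the Möbius-Plateau energy with coefficients $\alpha,\beta$ must have high frequency (equivalently, low pitch), very small width in comparison to the frequency, and remain close to the axis. That is, the following conditions on the parameters must hold: 1. $\omega>1$; 2. $|B-A|^2<C(\alpha,\beta)\,\omega$, where $C(\alpha,\beta)$ is a constant depending only on $\alpha$ and $\beta$; 3. $|A+B|<2$.
   Context: For a real frequency parameter $\omega$, the helicoid $\Sigma(\omega)$ is parametrized by $(s,t)\mapsto (s\cos(\omega t),\,s\sin(\omega t),\,t)$. For prescribed $A<B$, the helicoidal strip with parameters $A,B,\omega$ is the part of this parametrized surface with $A\le s\le B$, $t\in\mathbb{R}$; it is called a helicoidal ribbon when $A$ and $B$ have the same signs (and a helicoidal screw when they have opposite signs). Its boundary curves are the helices $$\gamma_1(u)=(A\cos(\omega u),A\sin(\omega u),u),\qquad \gamma_2(v)=(B\cos(\omega v),B\sin(\omega v),v),\qquad u,v\in\mathbb{R}.$$ The $L^2$ gradient of the Möbius energy of the link $(\gamma_1,\gamma_2)$ at the point $\gamma_1(u)$ is given by $$G_{\gamma_1,\gamma_2}(u)=2\int_{\mathbb{R}}\left[\frac{2P_{\dot\gamma_1(u)^\perp}(\gamma_2(v)-\gamma_1(u))}{|\gamma_2(v)-\gamma_1(u)|^2}-\mathbf{N}_{\gamma_1(u)}\right]\frac{|\dot\gamma_2(v)|\,dv}{|\gamma_2(v)-\gamma_1(u)|^2},$$ where $P_{\dot\gamma_1(u)^\perp}$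 is the orthogonal projection onto the plane orthogonal to $\dot\gamma_1(u)$ and $\mathbf{N}_{\gamma_1(u)}$ is the normal vector of the Frenet frame of $\gamma_1$ at $\gamma_1(u)$. The gradient at a point $\gamma_2(v)$ is defined by the same formula with the roles of $(\gamma_1,u)$ and $(\gamma_2,v)$ exchanged. Let $\mathbf{n}$ be the unit conormal of the strip along its boundary (tangent to the surface, orthogonal to the boundary curve, pointing away from the strip); explicitly, $\mathbf{n}=-(\cos(\omega u),\sin(\omega u),0)$ at $\gamma_1(u)$ and $\mathbf{n}=(\cos(\omega v),\sin(\omega v),0)$ at $\gamma_2(v)$. It is the direction of the $L^2$ gradient of the Plateau (spanning area) energy. The Möbius-Plateau energy with coefficients $\alpha,\beta$ is $\alpha$ times the Möbius energy plus $\beta$ times the Plateau energy. Both energies are infinite for these curves, so stationarity is understood through the variational equation: the strip is called stationary if $$\alpha\,G_{\gamma_1,\gamma_2}=-\beta\,\mathbf{n}$$ holds along both boundary curves $\gamma_1$ and $\gamma_2$.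
   Formalization: α and β are assumed not both zero (otherwise every ribbon is stationary and the claim fails); ω is nonzero (else no Frenet normal), and conditions 1 and 2 are stated with |ω|, since reflection turns a stationary ribbon with ω into one with −ω. *)

(* Defs.v *)
From Stdlib Require Export Reals.
From Coquelicot Require Export Coquelicot.
Open Scope R_scope.

(* [plus], [minus], [opp], [scal] and [is_RInt_gen] are used at Coquelicot's
   product module structure on triples. *)
Definition vec3 : Type := (R * R * R)%type.

Definition dot (x y : vec3) : R :=
  let '(x1, x2, x3) := x in
  let '(y1, y2, y3) := y in
  x1 * y1 + x2 * y2 + x3 * y3.

Definition enorm (x : vec3) : R := sqrt (dot x x).

Definition velocity (g : R -> vec3) (t : R) : vec3 :=
  (Derive (fun r => fst (fst (g r))) t,
   Derive (fun r => snd (fst (g r))) t,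
   Derive (fun r => snd (g r)) t).

Definition unit_tangent (g : R -> vec3) (t : R) : vec3 :=
  scal (/ enorm (velocity g t)) (velocity g t).

(* The unit vector T' / |T'| (not the curvature vector); it is the Frenet
   normal only where the curvature of [g] does not vanish. *)
Definition frenet_normal (g : R -> vec3) (t : R) : vec3 :=
  scal (/ enorm (velocity (unit_tangent g) t)) (velocity (unit_tangent g) t).

Definition proj_perp (w x : vec3) : vec3 :=
  minus x (scal (dot x w / dot w w) w).

Definition moebius_integrand (g1 g2 : R -> vec3) (u v : R) : vec3 :=
  let d := minus (g2 v) (g1 u) in
  scal (enorm (velocity g2 v) / enorm d ^ 2)
    (minus (scal (/ (enorm d ^ 2)) (scal 2 (proj_perp (velocity g1 u) d)))
           (frenet_normal g1 u)).

(* [G] is the L^2 gradient at [g1 u] of the Moebius energy of the link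
   (g1, g2); the improper integral over R is required to converge.  For the helices
   below the integrand is continuous and O(1/v^2), so the integral converges
   absolutely and is the Lebesgue integral. *)
Definition is_moebius_gradient (g1 g2 : R -> vec3) (u : R) (G : vec3) : Prop :=
  exists I : vec3,
    is_RInt_gen (moebius_integrand g1 g2 u)
      (Rbar_locally m_infty) (Rbar_locally p_infty) I /\
    G = scal 2 I.

Definition helicoid (omega s t : R) : vec3 :=
  (s * cos (omega * t), s * sin (omega * t), t).

(* The derivative of [helicoid] in [s]: a unit field tangent to the helicoid,
   orthogonal to its helices and pointing towards increasing [s]. *)
Definition radial (omega t : R) : vec3 := (cos (omega * t), sin (omega * t), 0).

Definition is_ribbon (A B : R) : Prop :=
  A < B /\ ((0 < A /\ 0 < B) \/ (A < 0 /\ B < 0)).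

(* The outward conormal of the strip A <= s <= B is [opp (radial omega u)]
   along s = A and [radial omega v] along s = B. *)
Definition stationary (alpha beta A B omega : R) : Prop :=
  (forall u : R, exists G : vec3,
     is_moebius_gradient (helicoid omega A) (helicoid omega B) u G /\
     scal alpha G = opp (scal beta (opp (radial omega u)))) /\
  (forall v : R, exists G : vec3,
     is_moebius_gradient (helicoid omega B) (helicoid omega A) v G /\
     scal alpha G = opp (scal beta (radial omega v))).

(* Main.v *)
Require Import Defs.
From Stdlib Require Import Reals Lra.
From Coquelicot Require Import Coquelicot.
Open Scope R_scope.

(** All the information needed sits in the radial component of the gradient, at
    one point of each boundary helix.  Write [p < q] for the distances of the
    two helices to the axis, [c = cos (omega v)] and
    [D = p^2 + q^2 - 2 p q c + v^2] for the squared chord.  The Frenet normal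
    points to the axis, so up to positive factors the radial components of the
    gradient along the inner and outer helix are
<<
      I1 = int (2 (q c - p) + D) / D^2 dv,   I2 = int (2 (p c - q) + D) / D^2 dv,
>>
    the factors being the speeds [sqrt (1 + q^2 omega^2)] of the outer helix for
    [I1] and [sqrt (1 + p^2 omega^2)] of the inner one for [I2]
    ([moebius_gradient_radial]).  The outward conormals of the two boundary
    curves are opposite, so stationarity makes the two radial components
    opposite, the inner one being nonnegative.  As the factor of [I1] is the
    larger one, [I1 + I2 <= 0] ([weighted_opposite_sum_nonpos]).

    But the integrand of [I1 + I2] is [2 (D - (p + q) (1 - c)) / D^2], and it is
    positive as soon as [p + q >= 2] or [|omega| <= 1]
    ([chord_sq_gt_of_far], [chord_sq_gt_of_slow]).  Hence [|omega| > 1] and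
    [p + q < 2].  The bound on the width follows from these two: on a ribbon
    [B - A < |A + B| < 2], so [(B - A)^2 < 4 < 4 |omega|]. *)

(** * Improper integrals over the line *)

Lemma is_RInt_gen_fst_fst (f : R -> vec3) (I : vec3) :
  is_RInt_gen f (Rbar_locally m_infty) (Rbar_locally p_infty) I ->
  is_RInt_gen (fun v => fst (fst (f v)))
    (Rbar_locally m_infty) (Rbar_locally p_infty) (fst (fst I)).
Proof.
  intros HI P HP.
  assert (HQ : locally I (fun y : vec3 => P (fst (fst y)))).
  { destruct HP as [e He]. exists e. intros y [[Hy _] _]. apply He. exact Hy. }
  specialize (HI _ HQ).
  unfold filtermapi in *.
  revert HI. apply filter_imp.
  intros ab [y [Hy HPy]].
  exists (fst (fst y)). split; [|exact HPy].
  apply is_RInt_fct_extend_fst, is_RInt_fct_extend_fst. exact Hy.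
Qed.

(** Strictness survives the limit because every interval containing the unit
    interval has an integral at least that of the unit interval. *)
Lemma is_RInt_gen_pos (f : R -> R) (I : R) :
  (forall v, continuous f v) -> (forall v, 0 < f v) ->
  is_RInt_gen f (Rbar_locally m_infty) (Rbar_locally p_infty) I -> 0 < I.
Proof.
  intros Hc Hpos HI.
  assert (Hex : forall a b, ex_RInt f a b)
    by (intros a b; apply (ex_RInt_continuous (V := R_CompleteNormedModule)); auto).
  assert (Hge : forall a b, a <= b -> 0 <= RInt f a b)
    by (intros a b Hab; apply RInt_ge_0; auto; intros; apply Rlt_le, Hpos).
  assert (He : 0 < RInt f 0 1) by (apply RInt_gt_0; auto; lra).
  destruct (Rlt_or_le 0 I) as [H|H]; [exact H|exfalso].
  assert (HP : locally I (fun y => y < RInt f 0 1)) by (apply open_lt; lra).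
  specialize (HI _ HP). unfold filtermapi in HI.
  destruct HI as [Q S [M1 HQ] [M2 HS] HQS].
  destruct (HQS (Rmin M1 0 - 1) (Rmax M2 1 + 1)) as [y [Hy Hlt]].
  { apply HQ. pose proof (Rmin_l M1 0). lra. }
  { apply HS. pose proof (Rmax_l M2 1). lra. }
  pose proof (Rmin_r M1 0). pose proof (Rmax_r M2 1).
  simpl in Hy. apply (is_RInt_unique (V := R_CompleteNormedModule)) in Hy.
  set (a := Rmin M1 0 - 1) in *. set (b := Rmax M2 1 + 1) in *.
  assert (Hsplit : RInt f a b = RInt f a 0 + (RInt f 0 1 + RInt f 1 b)).
  { rewrite <- (RInt_Chasles f a 0 b), <- (RInt_Chasles f 0 1 b) by auto.
    reflexivity. }
  assert (Ha : a <= 0) by (unfold a; lra). assert (Hb : 1 <= b) by (unfold b; lra).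
  pose proof (Hge a 0 Ha). pose proof (Hge 1 b Hb). lra.
Qed.

(** * The radial kernel *)

(** The squared distance between points of the helices with parameters [p] and
    [q], at heights differing by [v]. *)
Definition chord_sq (p q omega v : R) : R :=
  p ^ 2 + q ^ 2 - 2 * p * q * cos (omega * v) + v ^ 2.

(** The integrand of the gradient along the helix at distance [p], projected to
    the outward radial direction and divided by the speed of the other helix. *)
Definition radial_kernel (p q omega v : R) : R :=
  (2 * (q * cos (omega * v) - p) + chord_sq p q omega v)
    / chord_sq p q omega v ^ 2.

Lemma chord_sq_sym (p q omega v : R) :
  chord_sq p q omega v = chord_sq q p omega v.
Proof. unfold chord_sq. ring. Qed.

Lemma chord_sq_expand (p q omega v : R) :
  chord_sq p q omega v =
    (q - p) ^ 2 + 2 * (p * q * (1 - cos (omega * v))) + v ^ 2.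
Proof. unfold chord_sq. ring. Qed.

Lemma chord_sq_pos (p q omega v : R) :
  0 < p -> 0 < q -> p <> q -> 0 < chord_sq p q omega v.
Proof.
  intros Hp Hq Hpq. rewrite chord_sq_expand.
  pose proof (COS_bound (omega * v)). pose proof (pow2_ge_0 v).
  assert (0 < (q - p) ^ 2) by (apply pow2_gt_0; lra).
  assert (0 <= p * q * (1 - cos (omega * v)))
    by (apply Rmult_le_pos; [nra|lra]).
  lra.
Qed.

Lemma radial_kernel_continuous (p q omega v : R) :
  0 < p -> 0 < q -> p <> q -> continuous (radial_kernel p q omega) v.
Proof.
  intros Hp Hq Hpq.
  pose proof (chord_sq_pos p q omega v Hp Hq Hpq) as HD.
  unfold chord_sq in HD.
  apply (ex_derive_continuous (V := R_NormedModule)).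
  unfold radial_kernel, chord_sq. auto_derive.
  repeat split. simpl in HD. apply Rgt_not_eq. nra.
Qed.

Lemma one_minus_cos_bounds (x : R) : 0 <= 1 - cos x <= x ^ 2 / 2.
Proof.
  assert (Hs : forall y, 0 <= y -> sin y ^ 2 <= y ^ 2).
  { intros y Hy. pose proof (SIN_bound y). pose proof PI_4. pose proof PI2_1.
    destruct (Req_dec y 0) as [->|Hy0]; [rewrite sin_0; lra|].
    destruct (Rle_or_lt 1 y); [nra|].
    pose proof (sin_lt_x y ltac:(lra)).
    pose proof (sin_gt_0 y ltac:(lra) ltac:(lra)). nra. }
  assert (Hs' : sin (x / 2) ^ 2 <= (x / 2) ^ 2).
  { destruct (Rle_or_lt 0 (x / 2)); [auto|].
    specialize (Hs (- (x / 2)) ltac:(lra)). rewrite sin_neg in Hs. nra. }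
  replace (cos x) with (cos (2 * (x / 2))) by (f_equal; field).
  rewrite cos_2a_sin. nra.
Qed.

(** The difference of the two sides is affine in [cos (omega v)]; its values at
    cosine [1] and [-1] are [(q - p)^2 + v^2] and [(p + q) (p + q - 2) + v^2]. *)
Lemma chord_sq_gt_of_far (p q omega v : R) :
  0 < p -> p < q -> 2 <= p + q ->
  (p + q) * (1 - cos (omega * v)) < chord_sq p q omega v.
Proof.
  intros Hp Hpq Hfar.
  pose proof (COS_bound (omega * v)) as Hc.
  assert (E : chord_sq p q omega v - (p + q) * (1 - cos (omega * v)) =
    v ^ 2 + (q - p) ^ 2 * (1 + cos (omega * v)) / 2
    + (p + q) * (p + q - 2) * (1 - cos (omega * v)) / 2)
    by (unfold chord_sq; field).
  assert (H1 : 0 <= (q - p) ^ 2 * (1 + cos (omega * v)))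
    by (apply Rmult_le_pos; [apply pow2_ge_0|lra]).
  assert (H2 : 0 <= (p + q) * (p + q - 2) * (1 - cos (omega * v)))
    by (repeat apply Rmult_le_pos; lra).
  destruct (Req_dec v 0) as [->|Hv].
  - (* here the cosine is 1 and the width is what makes the difference positive *)
    rewrite Rmult_0_r, cos_0 in *. nra.
  - pose proof (pow2_gt_0 v Hv). lra.
Qed.

(** For [p + q <= 2] the term [v^2] of the squared chord absorbs
    [(p + q) (1 - cos (omega v)) <= (omega v)^2]. *)
Lemma chord_sq_gt_of_slow (p q omega v : R) :
  0 < p -> p < q -> p + q <= 2 -> Rabs omega <= 1 ->
  (p + q) * (1 - cos (omega * v)) < chord_sq p q omega v.
Proof.
  intros Hp Hpq Hnear Hslow.
  destruct (one_minus_cos_bounds (omega * v)) as [Hc0 Hc].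
  assert (Hw : omega ^ 2 <= 1).
  { rewrite <- pow2_abs. pose proof (Rabs_pos omega). nra. }
  assert (Hwv : (omega * v) ^ 2 <= v ^ 2).
  { rewrite Rpow_mult_distr. pose proof (pow2_ge_0 v). nra. }
  rewrite chord_sq_expand.
  assert (H1 : 0 < (q - p) ^ 2) by (apply pow2_gt_0; lra).
  assert (H2 : 0 <= p * q * (1 - cos (omega * v)))
    by (apply Rmult_le_pos; [nra|lra]).
  assert (H3 : (p + q) * (1 - cos (omega * v)) <= 2 * (1 - cos (omega * v)))
    by (apply Rmult_le_compat_r; lra).
  lra.
Qed.

Lemma radial_kernel_sum_pos (p q omega v : R) :
  0 < p -> p < q ->
  (p + q) * (1 - cos (omega * v)) < chord_sq p q omega v ->
  0 < radial_kernel p q omega v + radial_kernel q p omega v.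
Proof.
  intros Hp Hpq H.
  pose proof (chord_sq_pos p q omega v Hp ltac:(lra) ltac:(lra)) as HD.
  unfold radial_kernel. rewrite (chord_sq_sym q p).
  rewrite <- Rdiv_plus_distr.
  apply Rdiv_lt_0_compat; [lra|]. apply pow_lt, HD.
Qed.

(** The factor of [I1] exceeds that of [I2], so the nonnegative [I1] is at most
    [- I2] in size. *)
Lemma weighted_opposite_sum_nonpos (p q omega k I1 I2 : R) :
  0 < p -> p < q -> 0 <= k ->
  sqrt (1 + q ^ 2 * omega ^ 2) * I1 = k ->
  sqrt (1 + p ^ 2 * omega ^ 2) * I2 = - k ->
  I1 + I2 <= 0.
Proof.
  intros Hp Hpq Hk H1 H2.
  pose proof (pow2_ge_0 omega).
  assert (Hle : sqrt (1 + p ^ 2 * omega ^ 2) <= sqrt (1 + q ^ 2 * omega ^ 2)).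
  { apply sqrt_le_1_alt. assert (p ^ 2 <= q ^ 2) by nra. nra. }
  assert (Hpos : 0 < sqrt (1 + p ^ 2 * omega ^ 2)).
  { apply sqrt_lt_R0. pose proof (pow2_ge_0 p). nra. }
  set (x := sqrt (1 + p ^ 2 * omega ^ 2)) in *.
  set (y := sqrt (1 + q ^ 2 * omega ^ 2)) in *.
  assert (HI1 : 0 <= I1) by (apply (Rmult_le_reg_l y); lra).
  assert (HxI1 : x * I1 <= y * I1) by (apply Rmult_le_compat_r; lra).
  apply (Rmult_le_reg_l x); lra.
Qed.

(** Here [p] and [q] are the distances of the inner and outer helix to the axis,
    whichever sign the parameters of the ribbon have. *)
Lemma radial_balance_bounds (p q omega k I1 I2 : R) :
  0 < p -> p < q -> 0 <= k ->
  is_RInt_gen (radial_kernel p q omega)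
    (Rbar_locally m_infty) (Rbar_locally p_infty) I1 ->
  is_RInt_gen (radial_kernel q p omega)
    (Rbar_locally m_infty) (Rbar_locally p_infty) I2 ->
  sqrt (1 + q ^ 2 * omega ^ 2) * I1 = k ->
  sqrt (1 + p ^ 2 * omega ^ 2) * I2 = - k ->
  1 < Rabs omega /\ p + q < 2.
Proof.
  intros Hp Hpq Hk HI1 HI2 E1 E2.
  pose proof (weighted_opposite_sum_nonpos p q omega k I1 I2 Hp Hpq Hk E1 E2).
  assert (Hsum : is_RInt_gen
    (fun v => radial_kernel p q omega v + radial_kernel q p omega v)
    (Rbar_locally m_infty) (Rbar_locally p_infty) (I1 + I2))
    by exact (is_RInt_gen_plus _ _ _ _ HI1 HI2).
  assert (Hcontra :
    ~ forall v, (p + q) * (1 - cos (omega * v)) < chord_sq p q omega v).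
  { intros Hall. apply (Rlt_not_le (I1 + I2) 0); [|assumption].
    apply (is_RInt_gen_pos _ _) in Hsum; [exact Hsum| |].
    - intros v. apply (continuous_plus (V := R_NormedModule));
        apply radial_kernel_continuous; lra.
    - intros v. apply radial_kernel_sum_pos; auto. }
  destruct (Rle_or_lt 2 (p + q)) as [Hfar|Hnear].
  { exfalso. apply Hcontra. intros v. apply chord_sq_gt_of_far; lra. }
  destruct (Rle_or_lt (Rabs omega) 1) as [Hslow|Hfast]; [|split; lra].
  exfalso. apply Hcontra. intros v. apply chord_sq_gt_of_slow; lra.
Qed.

(** * Geometry of the helices *)

Lemma scal_coord (k x y z : R) :
  scal k ((x, y, z) : vec3) = (k * x, k * y, k * z).
Proof. reflexivity. Qed.

Lemma scal_fst_fst (k : R) (x : vec3) : fst (fst (scal k x)) = k * fst (fst x).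
Proof. reflexivity. Qed.

Lemma minus_fst_fst (x y : vec3) :
  fst (fst (minus x y)) = fst (fst x) - fst (fst y).
Proof. reflexivity. Qed.

Lemma velocity_helicoid (omega s t : R) :
  velocity (helicoid omega s) t =
    (- (s * omega * sin (omega * t)), s * omega * cos (omega * t), 1).
Proof.
  unfold velocity, helicoid; simpl. f_equal; [f_equal|];
    apply is_derive_unique; auto_derive; auto; ring.
Qed.

Lemma speed_helicoid (omega s t : R) :
  enorm (velocity (helicoid omega s) t) = sqrt (1 + s ^ 2 * omega ^ 2).
Proof.
  rewrite velocity_helicoid. unfold enorm, dot. f_equal.
  pose proof (sin2_cos2 (omega * t)) as H. unfold Rsqr in H.
  replace 1 with (sin (omega * t) * sin (omega * t)
    + cos (omega * t) * cos (omega * t)) at 3 by exact H.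
  transitivity (1 * 1 + s ^ 2 * omega ^ 2 *
    (sin (omega * t) * sin (omega * t) + cos (omega * t) * cos (omega * t)));
    [ring|rewrite H; ring].
Qed.

Lemma frenet_normal_helicoid (omega s : R) :
  omega <> 0 -> s <> 0 ->
  frenet_normal (helicoid omega s) 0 = (- (s / Rabs s), 0, 0).
Proof.
  intros Hw Hs.
  set (W := sqrt (1 + s ^ 2 * omega ^ 2)).
  assert (HW : 0 < W).
  { apply sqrt_lt_R0. pose proof (pow2_ge_0 (s * omega)). nra. }
  assert (HT : forall t, unit_tangent (helicoid omega s) t =
    (/ W * - (s * omega * sin (omega * t)),
     / W * (s * omega * cos (omega * t)), / W * 1)).
  { intros t. unfold unit_tangent.
    rewrite speed_helicoid, velocity_helicoid. reflexivity. }
  assert (Hacc : velocity (unit_tangent (helicoid omega s)) 0 =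
    (- (s * omega ^ 2 / W), 0, 0)).
  { unfold velocity. f_equal; [f_equal|];
      erewrite Derive_ext by (intros t; rewrite HT; simpl; reflexivity);
      apply is_derive_unique; auto_derive; auto;
      rewrite ?Rmult_0_r, ?sin_0, ?cos_0; field; lra. }
  unfold frenet_normal. rewrite Hacc.
  assert (Hn : enorm (- (s * omega ^ 2 / W), 0, 0) = Rabs s * omega ^ 2 / W).
  { unfold enorm, dot.
    rewrite <- (sqrt_pow2 (Rabs s * omega ^ 2 / W)).
    - f_equal. unfold Rdiv. rewrite !Rpow_mult_distr, pow2_abs. ring.
    - apply Rdiv_le_0_compat; [|lra].
      apply Rmult_le_pos; [apply Rabs_pos|apply pow2_ge_0]. }
  rewrite Hn, scal_coord. apply Rabs_no_R0 in Hs.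
  f_equal; [f_equal|]; field; repeat split; auto; lra.
Qed.

Lemma enorm_chord (omega a b v : R) :
  enorm (minus (helicoid omega b v) (helicoid omega a 0)) ^ 2
  = chord_sq a b omega v.
Proof.
  unfold enorm. rewrite pow2_sqrt.
  - unfold helicoid, minus, plus, opp, chord_sq; simpl.
    rewrite Rmult_0_r, cos_0, sin_0. unfold plus, opp; simpl.
    pose proof (sin2_cos2 (omega * v)) as H. unfold Rsqr in H.
    transitivity (b * b * (sin (omega * v) * sin (omega * v)
      + cos (omega * v) * cos (omega * v))
      + a * a - 2 * a * b * cos (omega * v) + v * v); [ring|rewrite H; ring].
  - destruct (minus _ _) as [[x y] z]. unfold dot. nra.
Qed.

(** At height [0] the velocity of the helix has no component along the first
    axis, so the projection leaves the radial component of the chord unchanged.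
    Multiplying by the sign of [a] turns the first coordinate into the outward
    radial one. *)
Lemma moebius_integrand_radial (omega a b v : R) :
  omega <> 0 -> 0 < a * b -> a <> b ->
  a / Rabs a *
    fst (fst (moebius_integrand (helicoid omega a) (helicoid omega b) 0 v)) =
  sqrt (1 + b ^ 2 * omega ^ 2) * radial_kernel (Rabs a) (Rabs b) omega v.
Proof.
  intros Hw Hab Hne.
  assert (Ha : a <> 0) by (intros ->; lra).
  unfold moebius_integrand. cbv zeta.
  rewrite frenet_normal_helicoid, speed_helicoid, enorm_chord by assumption.
  rewrite velocity_helicoid. unfold proj_perp.
  rewrite scal_fst_fst, minus_fst_fst, !scal_fst_fst, !minus_fst_fst,
    scal_fst_fst.
  set (k := dot _ _ / dot _ _).
  unfold helicoid; cbn [fst].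
  rewrite Rmult_0_r, sin_0, cos_0.
  assert (HD : chord_sq (Rabs a) (Rabs b) omega v = chord_sq a b omega v).
  { unfold chord_sq. rewrite !pow2_abs.
    replace (2 * Rabs a * Rabs b) with (2 * (Rabs a * Rabs b)) by ring.
    rewrite <- Rabs_mult, (Rabs_pos_eq (a * b)) by lra. ring. }
  assert (HDpos : 0 < chord_sq a b omega v).
  { rewrite <- HD. apply chord_sq_pos.
    - apply Rabs_pos_lt, Ha.
    - apply Rabs_pos_lt. intros ->. lra.
    - intros E. apply Hne. unfold Rabs in E.
      destruct (Rcase_abs a), (Rcase_abs b); nra. }
  unfold radial_kernel. rewrite HD.
  set (D := chord_sq a b omega v) in *.
  destruct (Rlt_or_le 0 a) as [Hp|Hn].
  - assert (0 < b) by (apply (Rmult_lt_reg_l a); lra).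
    rewrite (Rabs_pos_eq a), (Rabs_pos_eq b) by lra. field. split; lra.
  - assert (b < 0) by nra.
    rewrite (Rabs_left a), (Rabs_left b) by lra. field. split; lra.
Qed.

Lemma moebius_gradient_radial (omega a b : R) (G : vec3) :
  omega <> 0 -> 0 < a * b -> a <> b ->
  is_moebius_gradient (helicoid omega a) (helicoid omega b) 0 G ->
  exists I : R,
    is_RInt_gen (radial_kernel (Rabs a) (Rabs b) omega)
      (Rbar_locally m_infty) (Rbar_locally p_infty) I /\
    a / Rabs a * fst (fst G) = 2 * (sqrt (1 + b ^ 2 * omega ^ 2) * I).
Proof.
  intros Hw Hab Hne [I [HI ->]].
  assert (HW : 0 < sqrt (1 + b ^ 2 * omega ^ 2)).
  { apply sqrt_lt_R0. pose proof (pow2_ge_0 (b * omega)). nra. }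
  set (W := sqrt (1 + b ^ 2 * omega ^ 2)) in *.
  apply is_RInt_gen_fst_fst in HI.
  apply (is_RInt_gen_scal _ (/ W * (a / Rabs a))) in HI.
  exists (/ W * (a / Rabs a) * fst (fst I)). split.
  - eapply is_RInt_gen_ext; [|exact HI].
    apply filter_forall. intros ab v _.
    change (/ W * (a / Rabs a) *
      fst (fst (moebius_integrand (helicoid omega a) (helicoid omega b) 0 v)) =
      radial_kernel (Rabs a) (Rabs b) omega v).
    rewrite Rmult_assoc, moebius_integrand_radial by assumption.
    fold W. field. lra.
  - rewrite scal_fst_fst. field. split; [|lra]. apply Rabs_no_R0. intros ->. lra.
Qed.

(** * Stationary ribbons *)

Theorem theorem11 (alpha beta : R) (Halpha : 0 <= alpha) (Hbeta : 0 <= beta)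
    (Hnontrivial : alpha <> 0 \/ beta <> 0) :
  exists C : R,
    forall A B omega : R,
      is_ribbon A B ->
      omega <> 0 ->
      stationary alpha beta A B omega ->
      Rabs omega > 1 /\
      Rabs (B - A) ^ 2 < C * Rabs omega /\
      Rabs (A + B) < 2.
Proof.
  exists 4. intros A B omega [HAB Hsign] Hw [S1 S2].
  destruct (S1 0) as [G1 [HG1 E1]]. destruct (S2 0) as [G2 [HG2 E2]].
  (* at height 0 the first coordinate axis is the radial direction *)
  apply (f_equal (fun x : vec3 => fst (fst x))) in E1.
  apply (f_equal (fun x : vec3 => fst (fst x))) in E2.
  change (alpha * fst (fst G1) = - (beta * - cos (omega * 0))) in E1.
  change (alpha * fst (fst G2) = - (beta * cos (omega * 0))) in E2.
  rewrite Rmult_0_r, cos_0 in E1, E2.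
  assert (Ha : 0 < alpha).
  { destruct (Req_dec alpha 0) as [H0|H0]; [|lra].
    exfalso. rewrite H0 in E1.
    destruct Hnontrivial; lra. }
  assert (Hk : 0 <= beta / (2 * alpha)) by (apply Rdiv_le_0_compat; lra).
  assert (F1 : fst (fst G1) = 2 * (beta / (2 * alpha))).
  { apply (Rmult_eq_reg_l alpha); [|lra].
    rewrite E1. field. lra. }
  assert (F2 : fst (fst G2) = - (2 * (beta / (2 * alpha)))).
  { apply (Rmult_eq_reg_l alpha); [|lra].
    rewrite E2. field. lra. }
  destruct (moebius_gradient_radial omega A B G1) as [I1 [HI1 V1]];
    [assumption|nra|lra|exact HG1|].
  destruct (moebius_gradient_radial omega B A G2) as [I2 [HI2 V2]];
    [assumption|nra|lra|exact HG2|].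
  rewrite F1 in V1. rewrite F2 in V2.
  assert (Hmain : 1 < Rabs omega /\ Rabs (A + B) < 2).
  { destruct Hsign as [[HA HB]|[HA HB]].
    - rewrite (Rabs_pos_eq A), (Rabs_pos_eq B) in * by lra.
      rewrite (Rabs_pos_eq (A + B)) by lra.
      replace (A / A) with 1 in V1 by (field; lra).
      replace (B / B) with 1 in V2 by (field; lra).
      apply (radial_balance_bounds A B omega (beta / (2 * alpha)) I1 I2);
        auto; lra.
    - (* the helix of parameter B is now the inner one *)
      rewrite (Rabs_left A), (Rabs_left B) in * by lra.
      rewrite (Rabs_left (A + B)) by lra.
      replace (A / - A) with (-1) in V1 by (field; lra).
      replace (B / - B) with (-1) in V2 by (field; lra).
      replace (- (A + B)) with (- B + - A) by ring.
      apply (radial_balance_bounds (- B) (- A) omega (beta / (2 * alpha)) I2 I1);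
        auto; try lra.
      + replace ((- A) ^ 2) with (A ^ 2) by ring. lra.
      + replace ((- B) ^ 2) with (B ^ 2) by ring. lra. }
  destruct Hmain as [Hfast Hnear]. split; [exact Hfast|split; [|exact Hnear]].
  rewrite pow2_abs.
  apply Rabs_def2 in Hnear.
  assert ((B - A) ^ 2 < 4) by (destruct Hsign; nra). lra.
Qed.
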